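(* Given $d\in\mathbb{N}$, let $\mathcal{H}$ be the family of all finite $3$-partite $3$-hypergraphs $H=(E;X,Y,Z)$ such that $E$ viewed as a binary relation on $X\times Y$ and $Z$ (i.e. as a subset of $(X\times Y)\times Z$) is $d$-stable, and for every $z\in Z$ the binary slice $E_z=\{(x,y):(x,y,z)\in E\}\subseteq X\times Y$ is $d$-stable. Then $\mathcal{H}$ satisfies strong stable regularity.
   Context: A finite $3$-partite $3$-hypergraph is $H=(E;X_1,X_2,X_3)$ with $X_i$ finite nonempty sets and $E\subseteq X_1\times X_2\times X_3$. A binary relation $R\subseteq A\times B$ is $d$-stable if there are no $a_1,\dots,a_d\in A$, $b_1,\dots,b_d\in B$ with $(a_i,b_j)\in R\iff i\le j$ for all $1\le i,j\le d$. A family $\mathcal{H}$ satisfies strong stable regularity if for every $\varepsilon>0$ and every $f:\mathbb{N}\to(0,1]$ there is $N=N(f,\varepsilon)$ so that for any $H=(E;X_1,X_2,X_3)\in\mathcal{H}$ there exist $N'\le N$ and partitions $X_i=\bigsqcup_{0\le t<N'}A_{i,t}$ ($1\le i\le3$) with (a) $|A_{i,0}|\le\varepsilon|A_{i,1}|$ for all $i$; (b) for any $1\le t_1,t_2,t_3<N'$, $\frac{|E\cap(A_{1,t_1}\times A_{2,t_2}\times A_{3,t_3})|}{|A_{1,t_1}\times A_{2,t_2}\times A_{3,t_3}|}\in[0,f(N'))\cup(1-f(N'),1]$. Convention: parts of partitions may be empty; conditions on a ratio are only required when the denominator is nonzero. *)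

(* Defs.v *)
From mathcomp Require Import all_boot all_order all_algebra.
From mathcomp Require Import reals.

Set Implicit Arguments.
Unset Strict Implicit.
Unset Printing Implicit Defensive.

Import Order.TTheory GRing.Theory Num.Theory.

Record hypergraph3 := Hypergraph3 {
  part1 : finType;
  part2 : finType;
  part3 : finType;
  part1_gt0 : 0 < #|part1|;
  part2_gt0 : 0 < #|part2|;
  part3_gt0 : 0 < #|part3|;
  edges : {set part1 * part2 * part3}
}.

Definition stable (d : nat) (A B : finType) (S : {set A * B}) : Prop :=
  ~ exists (a : 'I_d -> A) (b : 'I_d -> B),
      forall i j : 'I_d, ((a i, b j) \in S) <-> (i <= j).

Definition slice3 (X Y Z : finType) (E : {set X * Y * Z}) (z : Z) :
  {set X * Y} := [set p | (p, z) \in E].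

(* The parts are A 0, ..., A n.-1; unlike in finset's [partition], they may be
   empty. The values of A from n on are irrelevant. *)
Definition partition_into (T : finType) (n : nat) (A : nat -> {set T}) :
    Prop :=
  \bigcup_(t < n) A t = [set: T] /\
  (forall s t, s < n -> t < n -> s != t -> [disjoint A s & A t]).

Local Open Scope ring_scope.

Definition density (R : realType) (T : finType) (E B : {set T}) : R :=
  #|E :&: B|%:R / #|B|%:R.

(* 1 < n only makes explicit that the part of index 1 exists. *)
Definition strong_stable_regularity (R : realType)
    (F : hypergraph3 -> Prop) : Prop :=
  forall (eps : R) (f : nat -> R),
    0 < eps -> (forall n, f n \in `]0, 1]) ->
    exists N : nat, forall H : hypergraph3, F H ->
    exists (n : nat) (A1 : nat -> {set part1 H}) (A2 : nat -> {set part2 H})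
        (A3 : nat -> {set part3 H}),
      [/\ (1 < n <= N)%N,
          [/\ partition_into n A1, partition_into n A2
            & partition_into n A3],
          [/\ #|A1 0%N|%:R <= eps * #|A1 1%N|%:R,
              #|A2 0%N|%:R <= eps * #|A2 1%N|%:R
            & #|A3 0%N|%:R <= eps * #|A3 1%N|%:R]
        & forall t1 t2 t3 : nat,
            (1 <= t1 < n)%N -> (1 <= t2 < n)%N -> (1 <= t3 < n)%N ->
            let B := setX (setX (A1 t1) (A2 t2)) (A3 t3) in
            #|B| <> 0%N ->
            (density R (edges H) B \in `[0, f n[) \/
            (density R (edges H) B \in `]1 - f n, 1]) ].

(* The type of [edges H] is {set (X * Y) * Z}, so it is directly a binary
   relation between X * Y and Z. *)
Definition slicewise_stable (d : nat) (H : hypergraph3) : Prop :=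
  stable d (edges H) /\ forall z : part3 H, stable d (slice3 (edges H) z).

(* Main.v *)
(** Suppose no bound N works and take an ultraproduct of counterexamples H_N
    along a nonprincipal ultrafilter U on the natural numbers; its internal
    sets are families of sets indexed by N, and such a set is large if it has
    positive standard density. A set is an atom for a family of sets if no
    member of the family cuts it into two large pieces. For the family of
    fibers of a relation without d-ladders, every large set contains an atom:
    otherwise one could build a ladder by repeated splitting. Choosing the
    largest remaining atoms greedily, countable saturation shows that finitely
    many of them cover all but an eps fraction of the first one.
    Apply this to Z and the fibers E_(x,y), with atoms C_1, ..., C_p. The
    relations g_k(x, y), saying that most z in C_k satisfy E(x, y, z), agree
    with E on almost all of C_k, so a ladder of g_k is a ladder of some slice
    E_z; hence they have no d-ladder. Take atoms A_s of X and B_t of Y for the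
    fibers of all g_k at once. Then the number n of parts is fixed, while the error of
    all atoms is infinitesimal, in particular small compared to f(n); and g_k
    is almost constant on A_s x B_t because its variance there is small. *)
Require Import Defs.
From mathcomp Require Import unstable boolp classical_sets filter.
From mathcomp Require Import all_boot all_order all_algebra.
From mathcomp Require Import reals.
From mathcomp Require Import zify.

Set Implicit Arguments.
Unset Strict Implicit.
Unset Printing Implicit Defensive.

(** * Counting in rectangles and boxes *)

Definition good (T : finType) (c : nat) (A F : {set T}) : Prop :=
  c * #|A :&: F| <= #|A| \/ c * #|A :\: F| <= #|A|.

Definition ladder (X Y : Type) (S : X -> Y -> bool) (d : nat) (a : nat -> X)
    (b : nat -> Y) : Prop :=
  forall i j, i < d -> j < d -> S (a i) (b j) = (i <= j).

(** Exchanging the two sides turns [i <= j] into [j <= i]; reversing both index ranges restores the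
    order. *)
Lemma ladder_tr (X Y : Type) (S : X -> Y -> bool) d a b :
  ladder (fun y x => S x y) d b a ->
  ladder S d (fun i => a (d.-1 - i)) (fun i => b (d.-1 - i)).
Proof.
move=> lad i j id jd; rewrite lad; lia.
Qed.

Lemma stable_ladder (A B : finType) (S : {set A * B}) d a b :
  stable d S -> ~ ladder (fun x y => (x, y) \in S) d a b.
Proof.
move=> st lad; apply: st.
exists (fun i => a i), (fun i => b i) => i j.
by rewrite lad.
Qed.

Lemma card_sum (T : finType) (A : {set T}) (P : pred T) :
  #|A :&: [set x | P x]| = \sum_(x in A) (P x : nat).
Proof.
rewrite -sum1_card big_mkcond [RHS]big_mkcond; apply: eq_bigr => x _.
by rewrite !inE; case: (x \in A); case: (P x).
Qed.

Lemma card_sumN (T : finType) (A : {set T}) (P : pred T) :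
  #|A :\: [set x | P x]| = \sum_(x in A) (~~ P x : nat).
Proof.
rewrite -card_sum; apply: eq_card => x; rewrite !inE; exact: andbC.
Qed.

Lemma good_sum (T : finType) (c : nat) (A : {set T}) (P : pred T) :
  good c A [set x | P x] ->
  c * ((\sum_(x in A) (P x : nat)) * \sum_(x in A) (~~ P x : nat))
    <= #|A| ^ 2.
Proof.
rewrite /good card_sum card_sumN => gd.
have le (Q : pred T) : \sum_(x in A) (Q x : nat) <= #|A|.
  rewrite -card_sum; exact/subset_leq_card/subsetIl.
have := le P; have := le (fun x => ~~ P x).
set p := \sum_(x in A) _ in gd *; set q := \sum_(x in A) _ in gd *.
move=> qA pA; rewrite -mulnn; case: gd => h.
  by rewrite mulnA leq_mul.
by rewrite mulnCA mulnC leq_mul.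
Qed.

(* [g] and [~~ g] at independent random points of the rectangle disagree only
   if the value of [g] changes along one of the two sides of the path
   (x, y), (x', y), (x', y'). *)
Lemma rectangle_variance (X Y : finType) (A : {set X}) (B : {set Y})
    (g : X -> Y -> bool) (c : nat) :
    (forall y, good c A [set x | g x y]) ->
    (forall x, good c B [set y | g x y]) ->
  c * ((\sum_(x in A) \sum_(y in B) (g x y : nat)) *
       \sum_(x in A) \sum_(y in B) (~~ g x y : nat))
    <= 2 * (#|A| * #|B|) ^ 2.
Proof.
move=> gA gB.
pose p x y := g x y : nat; pose q x y := ~~ g x y : nat.
have tri : (\sum_(x in A) \sum_(y in B) p x y) *
    (\sum_(x in A) \sum_(y in B) q x y) <=
  \sum_(x in A) \sum_(y in B) \sum_(x' in A) \sum_(y' in B)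
     (p x y * q x' y + p x' y * q x' y').
  rewrite big_distrl; apply: leq_sum => x xA.
  rewrite big_distrl; apply: leq_sum => y yB.
  rewrite big_distrr; apply: leq_sum => x' _.
  rewrite big_distrr; apply: leq_sum => y' _.
  by rewrite /p /q; case: (g x y); case: (g x' y); case: (g x' y').
have E1 : \sum_(x in A) \sum_(y in B) \sum_(x' in A) \sum_(y' in B)
     (p x y * q x' y) =
   #|B| * \sum_(y in B) ((\sum_(x in A) p x y) * \sum_(x in A) q x y).
  rewrite exchange_big big_distrr; apply: eq_bigr => y _ /=.
  rewrite big_distrl big_distrr; apply: eq_bigr => x _ /=.
  rewrite !big_distrr; apply: eq_bigr => x' _ /=.
  by rewrite sum_nat_const.
have E2 : \sum_(x in A) \sum_(y in B) \sum_(x' in A) \sum_(y' in B)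
     (p x' y * q x' y') =
   #|A| * \sum_(x in A) ((\sum_(y in B) p x y) * \sum_(y in B) q x y).
  rewrite sum_nat_const; congr (_ * _).
  rewrite exchange_big; apply: eq_bigr => x' _ /=.
  rewrite big_distrl; apply: eq_bigr => y _ /=.
  by rewrite !big_distrr.
have B1 : c * \sum_(y in B) ((\sum_(x in A) p x y) * \sum_(x in A) q x y)
    <= #|B| * #|A| ^ 2.
  rewrite big_distrr -sum_nat_const; apply: leq_sum => y _.
  exact: good_sum.
have B2 : c * \sum_(x in A) ((\sum_(y in B) p x y) * \sum_(y in B) q x y)
    <= #|A| * #|B| ^ 2.
  rewrite big_distrr -sum_nat_const; apply: leq_sum => x _.
  exact: good_sum.
apply: leq_trans (leq_mul (leqnn c) tri) _.
under eq_bigr => x _ do under eq_bigr => y _ do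
  under eq_bigr => x' _ do rewrite big_split /=.
under eq_bigr => x _ do under eq_bigr => y _ do rewrite big_split /=.
under eq_bigr => x _ do rewrite big_split /=.
rewrite big_split /= E1 E2 mulnDr mulnCA [c * (#|A| * _)]mulnCA.
have := leq_mul (leqnn #|B|) B1; have := leq_mul (leqnn #|A|) B2.
rewrite !expnS !expn0; nia.
Qed.

Lemma rectangle_sum (X Y : finType) (A : {set X}) (B : {set Y})
    (g : X -> Y -> bool) :
  \sum_(x in A) \sum_(y in B) (g x y : nat) +
  \sum_(x in A) \sum_(y in B) (~~ g x y : nat) = #|A| * #|B|.
Proof.
rewrite -big_split -sum_nat_const; apply: eq_bigr => x _ /=.
rewrite -big_split -[RHS]sum1_card; apply: eq_bigr => y _ /=.
by case: (g x y).
Qed.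

(** The larger sum is at least half of [#|A| * #|B|], so if both exceeded the fraction [1/c], the
    variance bound for [4 * c] would fail. *)
Lemma rectangle_homogeneous (X Y : finType) (A : {set X}) (B : {set Y})
    (g : X -> Y -> bool) (c : nat) :
    (forall y, good (4 * c) A [set x | g x y]) ->
    (forall x, good (4 * c) B [set y | g x y]) ->
  c * (\sum_(x in A) \sum_(y in B) (g x y : nat)) <= #|A| * #|B| \/
  c * (\sum_(x in A) \sum_(y in B) (~~ g x y : nat)) <= #|A| * #|B|.
Proof.
move=> gA gB; have := rectangle_variance gA gB.
have := rectangle_sum A B g.
set p := \sum_(x in A) _; set q := \sum_(x in A) _.
move=> <-; rewrite -mulnn.
case: (leqP (c * p) (p + q)) => [|h1 h]; first by left.
case: (leqP (c * q) (p + q)) => [|h2]; first by right.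
nia.
Qed.

(** Pairs with [g] true are few; over the other pairs every edge is an exception to [g]. Each kind
    fills at most [1/c] of the box, hence the factor 2. *)
Lemma box_le (X Y Z : finType) (E : {set X * Y * Z}) (A : {set X})
    (B : {set Y}) (C : {set Z}) (g : X -> Y -> bool) (c : nat) :
    (forall x y, c * #|[set z in C | ((x, y, z) \in E) && ~~ g x y]| <= #|C|) ->
    c * (\sum_(x in A) \sum_(y in B) (g x y : nat)) <= #|A| * #|B| ->
  c * #|E :&: setX (setX A B) C| <= 2 * #|setX (setX A B) C|.
Proof.
move=> hE hg; rewrite !cardsX.
have -> : #|E :&: setX (setX A B) C| =
    \sum_(x in A) \sum_(y in B) \sum_(z in C) (((x, y, z) \in E) : nat).
  rewrite pair_big_dep /= pair_big_dep /= -sum1_card.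
  rewrite big_mkcond [RHS]big_mkcond; apply: eq_bigr => -[[x y] z] _ /=.
  by rewrite !inE /=; case: (_ \in E); case: (x \in A); case: (y \in B);
     case: (z \in C).
have : \sum_(x in A) \sum_(y in B) \sum_(z in C) (((x, y, z) \in E) : nat) <=
   \sum_(x in A) \sum_(y in B) (g x y * #|C| +
       #|[set z in C | ((x, y, z) \in E) && ~~ g x y]|).
  apply: leq_sum => x _; apply: leq_sum => y _.
  rewrite -card_sum; case: (g x y) => /=.
    rewrite mul1n; apply: leq_trans (leq_addr _ _).
    exact/subset_leq_card/subsetIl.
  rewrite mul0n; apply: subset_leq_card; apply/subsetP => z.
  by rewrite !inE andbT.
move=> /(leq_mul (leqnn c)) h; apply: leq_trans h _.
under eq_bigr => x _ do rewrite big_split /=.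
rewrite big_split /= mulnDr mul2n -addnn; apply: leq_add.
  under eq_bigr => x _ do rewrite -big_distrl /=.
  rewrite -big_distrl /= mulnA; exact: leq_mul.
rewrite -mulnA -sum_nat_const big_distrr; apply: leq_sum => x _ /=.
rewrite -sum_nat_const big_distrr; exact: leq_sum.
Qed.

Lemma box_homogeneous (X Y Z : finType) (E : {set X * Y * Z}) (A : {set X})
    (B : {set Y}) (C : {set Z}) (g : X -> Y -> bool) (c : nat) :
    (forall x y,
       c * #|[set z in C | ((x, y, z) \in E) != g x y]| <= #|C|) ->
    (forall y, good (4 * c) A [set x | g x y]) ->
    (forall x, good (4 * c) B [set y | g x y]) ->
  let V := setX (setX A B) C in
  c * #|E :&: V| <= 2 * #|V| \/ c * #|V :\: E| <= 2 * #|V|.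
Proof.
move=> hE gA gB V; have [h|h] := rectangle_homogeneous gA gB; [left|right].
  apply: box_le h => x y; apply: leq_trans (hE x y); rewrite leq_mul //.
  apply: subset_leq_card; apply/subsetP => z; rewrite !inE.
  by case: (_ \in C); case: (_ \in E); case: (g x y).
(* The second alternative is the first one for the complements of [E] and [g]. *)
rewrite setDE setIC.
apply: (@box_le _ _ _ _ _ _ _ (fun x y => ~~ g x y)) h => x y.
apply: leq_trans (hE x y); rewrite leq_mul //.
apply: subset_leq_card; apply/subsetP => z; rewrite !inE.
by case: (_ \in C); case: (_ \in E); case: (g x y).
Qed.

(** Part 0 collects what the atoms leave over. Empty parts pad the list, so that all three vertex
    sets get equally many parts. *)
Definition parts_of (T : finType) (n : nat) (A : nat -> {set T})
    (t : nat) : {set T} :=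
  match t with
  | 0 => ~: \bigcup_(s < n) A s
  | s.+1 => if s < n then A s else set0
  end.

Lemma parts_of_partition (T : finType) (n m : nat) (A : nat -> {set T}) :
    n <= m ->
    (forall s t, s < n -> t < n -> s != t -> [disjoint A s & A t]) ->
  partition_into m.+1 (parts_of n A).
Proof.
move=> nm dis; split.
  apply/setP => x; rewrite [RHS]inE; apply/bigcupP.
  have [/bigcupP[s _ xs]|nx] := boolP (x \in \bigcup_(s < n) A s).
    have sm : s.+1 < m.+1 by have := ltn_ord s; lia.
    by exists (Ordinal sm) => //=; rewrite ltn_ord.
  by exists ord0 => //=; rewrite inE.
have dis0 s : parts_of n A 0 :&: parts_of n A s.+1 = set0.
  rewrite /=; case: ifP => sn; last by rewrite setI0.
  apply/eqP; rewrite setIC setI_eq0 disjoints_subset setCK.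
  exact: (bigcup_sup (Ordinal sn)).
move=> [|s] [|t] // _ _ st; rewrite -setI_eq0 ?dis0 //.
  by rewrite setIC dis0.
rewrite /=; case: ifP => sn; last by rewrite set0I.
case: ifP => tn; last by rewrite setI0.
by rewrite setI_eq0 dis.
Qed.

(** * Large sets and atoms along an ultrafilter *)

Section Ultraproduct.
Variables (U : set_system nat) (UU : UltraFilter U).
Hypothesis U_infty : forall m, U (fun N => m <= N).

Lemma ultra_not (P : nat -> Prop) : ~ U P -> U (fun N => ~ P N).
Proof. by move=> nP; have [|] := in_ultra_setVsetC P UU. Qed.

Lemma near_ex2 (P Q : nat -> Prop) : U P -> U Q -> exists N, P N /\ Q N.
Proof. move=> UP UQ; exact: filter_ex (filterI UP UQ). Qed.

Lemma near_ltn (d : nat) (P : nat -> nat -> Prop) :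
  (forall i, i < d -> U (P i)) -> U (fun N => forall i, i < d -> P i N).
Proof.
move=> h; have {}h : forall i : 'I_d, U (P i) by move=> i; exact: h.
apply: filterS (filter_forall _ h) => N hN i id; exact: (hN (Ordinal id)).
Qed.

Section Largeness.
Variable X : nat -> finType.
Hypothesis X_gt0 : forall N, 0 < #|X N|.
Implicit Types (A B F : forall N, {set X N}).
Implicit Type (Fam : (forall N, {set X N}) -> Prop).

Definition sub A B := forall N, A N \subset B N.

Definition large_by (c : nat) A := U (fun N => #|X N| <= c * #|A N|).

Definition large A := exists c, large_by c A.

Definition splits F A :=
  large (fun N => A N :&: F N) /\ large (fun N => A N :\: F N).

Definition atom Fam A := large A /\ forall F, Fam F -> ~ splits F A.

(** Density in the sense of partial orders: atoms lie below every large set. *)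
Definition dense Fam :=
  forall A, large A -> exists2 A', sub A' A & atom Fam A'.

Lemma large_by_sub c A B :
  U (fun N => A N \subset B N) -> large_by c A -> large_by c B.
Proof.
apply: filterS2 => N AB /leq_trans; apply.
by rewrite leq_mul // subset_leq_card.
Qed.

Lemma large_sub A B : sub A B -> large A -> large B.
Proof.
move=> AB [c cA]; exists c; apply: large_by_sub cA.
exact: filterE.
Qed.

Lemma splits_sub A B F : sub A B -> splits F A -> splits F B.
Proof.
move=> AB [l1 l2]; split; [apply: large_sub l1|apply: large_sub l2] => N.
  exact: setSI.
exact: setSD.
Qed.

Lemma small_near c A : ~ large A -> U (fun N => c * #|A N| < #|X N|).
Proof.
move=> sA; have /ultra_not : ~ U (fun N => #|X N| <= c * #|A N|).
  by move=> cA; apply: sA; exists c.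
by apply: filterS => N /negP; rewrite -ltnNge.
Qed.

Lemma atom_sub Fam A B : sub A B -> large A -> atom Fam B -> atom Fam A.
Proof.
move=> AB lA [_ aB]; split=> // F /aB nF sF; apply: nF; exact: splits_sub sF.
Qed.

Lemma large_nonempty A : large A -> U (fun N => A N != set0).
Proof.
move=> [c]; apply: filterS => N; rewrite -card_gt0; have := X_gt0 N; lia.
Qed.

Lemma largeT : large (fun N => setT).
Proof. by exists 1; apply: filterE => N; rewrite cardsT mul1n. Qed.

(** The choice [y] of one element per index is a point of the ultraproduct of the [Y N]. *)
Definition sections (Y : nat -> finType) (S : forall N, X N -> Y N -> bool) F :=
  exists y : forall N, Y N, F = fun N => [set x | S N x (y N)].

(** If [good] failed on a set of indices in [U], a bad [y] at each of them would give an internal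
    fiber. As it does not split [A], one of its two pieces is small, a contradiction. *)
Lemma atom_good c Fam (Y : nat -> finType) (S : forall N, X N -> Y N -> bool)
    A (y0 : forall N, Y N) :
    (forall F, sections S F -> Fam F) -> atom Fam A ->
  U (fun N => forall y, good c (A N) [set x | S N x y]).
Proof.
move=> SF [[K lA] aA]; apply: contrapT => /ultra_not bad.
have ex N : exists y, (exists y, ~ good c (A N) [set x | S N x y]) ->
    ~ good c (A N) [set x | S N x y].
  have [[y yP]|no] := pselect (exists y, ~ good c (A N) [set x | S N x y]).
    by exists y.
  by exists (y0 N).
pose y N := sval (cid (ex N)).
have bady : U (fun N => ~ good c (A N) [set x | S N x (y N)]).
  apply: filterS bad => N /existsNP hN; exact: (svalP (cid (ex N))).
pose F N := [set x | S N x (y N)].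
have /aA /not_andP nF : Fam F by apply: SF; exists y.
have : U (fun N => good c (A N) (F N)).
  case: nF => /(small_near (c * K)); apply: filterS2 lA => N lAN sN;
    [left|right]; nia.
move=> gd; by have [N []] := near_ex2 gd bady.
Qed.

Lemma dense_union Fam1 Fam2 :
  dense Fam1 -> dense Fam2 -> dense (fun F => Fam1 F \/ Fam2 F).
Proof.
move=> d1 d2 A /d1[A1 sA1 aA1]; have [A2 sA2 aA2] := d2 _ aA1.1.
exists A2; first by move=> N; apply: subset_trans (sA1 N).
have [lA2 aA2'] := aA2; split=> // F [F1|/aA2' //].
by have [_] := atom_sub sA2 lA2 aA1; apply.
Qed.

Lemma dense_unions (p : nat) (Fam : nat -> (forall N, {set X N}) -> Prop) :
    (forall k, k < p -> dense (Fam k)) ->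
  dense (fun F => exists2 k, k < p & Fam k F).
Proof.
elim: p => [|p IH] h A lA.
  by exists A => //; split=> // F [].
have /(_ A lA) [A' sA aA] :=
  dense_union (IH (fun k kp => h k (ltnW kp))) (h p (leqnn _)).
exists A' => //; have [lA' a] := aA; split=> // F [k]; rewrite ltnS leq_eqVlt.
case/predU1P => [->|kp] Fk; apply: a; first by right.
by left; exists k.
Qed.

(** * Ladders in sets without atoms *)

Section Ladder.
Variable Y : nat -> finType.
Variable S : forall N, X N -> Y N -> bool.
Arguments S : clear implicits.
Implicit Type P : (forall N, Y N) -> Prop.

Let fib (y : forall N, Y N) N := [set x | S N x (y N)].

(** This denies that [A] contains an atom for the fibers from [P]. The class [P] is carried along
    because the ladder construction thins out the parameters as well. *)
Definition rich A P :=
  large A /\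
  forall A', sub A' A -> large A' -> exists2 y, P y & splits (fib y) A'.

Lemma rich_sub A A' P : sub A' A -> large A' -> rich A P -> rich A' P.
Proof.
move=> AA lA [_ r]; split=> // B BA; apply: r => N; exact: subset_trans (AA N).
Qed.

(** If [P2] alone fails, it fails on some large [A'], and its fibers split no subset of [A'] either;
    there [P1] must do all the splitting. *)
Lemma rich_partition A P1 P2 :
    rich A (fun y => P1 y \/ P2 y) ->
  (exists2 A', sub A' A & rich A' P1) \/ rich A P2.
Proof.
move=> [lA r]; have [|nr] := pselect (rich A P2); first by right.
left; have [A' [sA' lA' nA']] : exists A', [/\ sub A' A, large A' &
    forall y, P2 y -> ~ splits (fib y) A'].
  apply: contrapT => no; apply: nr; split=> // A' sA' lA'.
  apply: contrapT => no'; apply: no; exists A'; split=> // y Py sy.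
  by apply: no'; exists y.
exists A' => //; split=> // A'' sA'' lA''.
have [|y [P1y|/nA' nP2y] sy] := r A'' _ lA''.
- by move=> N; apply: subset_trans (sA' N).
- by exists y.
- by case: nP2y; apply: splits_sub sy.
Qed.

(* An element of [A] is joined to all or to none of the parameters of a still
   rich pair, but which one is not under our control; a parameter is then
   chosen on the same side of the remaining pair. *)
Lemma rich_ladder A P (x0 : forall N, X N) (y0 : forall N, Y N) m k :
    rich A P ->
  (exists (a : nat -> forall N, X N) (b : nat -> forall N, Y N),
     (forall i, i < m -> U (fun N => a i N \in A N) /\ P (b i)) /\
     (forall i j, i < m -> j < m ->
        U (fun N => S N (a i N) (b j N) = (i <= j)))) \/
  (exists (a : nat -> forall N, X N) (b : nat -> forall N, Y N),
     (forall i, i < k -> U (fun N => a i N \in A N) /\ P (b i)) /\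
     (forall i j, i < k -> j < k ->
        U (fun N => S N (a i N) (b j N) = (j < i)))).
Proof.
have [n] := ubnP (m + k); elim: n m k A P => // n IH [|m] k A P.
  by move=> _ _; left; exists (fun=> x0), (fun=> y0).
case: k => [|k].
  by move=> _ _; right; exists (fun=> x0), (fun=> y0).
move=> mk r.
have [a aA] : exists a : forall N, X N, U (fun N => a N \in A N).
  exists (fun N => odflt (x0 N) [pick x in A N]).
  apply: filterS (large_nonempty r.1) => N /set0Pn[x xA].
  by case: pickP => [//|/(_ x)]; rewrite xA.
have : rich A (fun y => P y /\ U (fun N => S N (a N) (y N)) \/
                        P y /\ U (fun N => ~~ S N (a N) (y N))).
  have [lA rA] := r; split=> // A' sA lA'; have [y Py sy] := rA A' sA lA'.
  exists y => //.
  have [Ua|/ultra_not Ua] := pselect (U (fun N => S N (a N) (y N))).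
    by left.
  by right; split=> //; apply: filterS Ua => N /negP.
case/rich_partition => [[A' sA' r']|r'].
- have [y [Py ay] [_ ly]] := r'.2 A' (fun N => subxx _) r'.1.
  (* The remaining elements avoid the fiber of [y] and the remaining parameters are all joined to
     [a], so [a] and [y] go in front of a ladder for [i <= j]. *)
  set A'' := (fun N => A' N :\: fib y N) in ly.
  have sA'' : sub A'' A' by move=> N; apply: subsetDl.
  have inA N x : x \in A'' N -> x \in A N /\ S N x (y N) = false.
    rewrite !inE => /andP[/negbTE -> xA']; split=> //.
    exact: (fintype.subsetP (sA' N)).
  have [|[a' [b' [h1 h2]]]|[a' [b' [h1 h2]]]] :=
    IH m k.+1 A'' _ _ (rich_sub sA'' ly r'); first by lia.
  + left; exists (fun i => if i is i'.+1 then a' i' else a),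
                 (fun i => if i is i'.+1 then b' i' else y).
    split=> [[|i] im|[|i] [|j] im jm] //.
    * by have [aA'' [Pb _]] := h1 i im; split=> //;
         apply: filterS aA'' => N /inA[].
    * by have [_ [_]] := h1 j jm; apply: filterS => N ->.
    * by have [+ _] := h1 i im; apply: filterS => N /inA[].
    * exact: h2.
  + right; exists a', b'; split=> // i ik.
    by have [aA'' [Pb _]] := h1 i ik; split=> //;
         apply: filterS aA'' => N /inA[].
- have [y [Py ay] [ly _]] := r'.2 A (fun N => subxx _) r'.1.
  (* Here the remaining elements are joined to [y] and [a] to no remaining parameter: a first rung
     of a ladder for [j < i]. *)
  set A'' := (fun N => A N :&: fib y N) in ly.
  have sA'' : sub A'' A by move=> N; apply: subsetIl.
  have inA N x : x \in A'' N -> x \in A N /\ S N x (y N).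
    by rewrite !inE => /andP[].
  have [|[a' [b' [h1 h2]]]|[a' [b' [h1 h2]]]] :=
    IH m.+1 k A'' _ _ (rich_sub sA'' ly r'); first by lia.
  + left; exists a', b'; split=> // i ik.
    by have [aA'' [Pb _]] := h1 i ik; split=> //;
         apply: filterS aA'' => N /inA[].
  + right; exists (fun i => if i is i'.+1 then a' i' else a),
                 (fun i => if i is i'.+1 then b' i' else y).
    split=> [[|i] im|[|i] [|j] im jm] //.
    * by have [aA'' [Pb _]] := h1 i im; split=> //;
         apply: filterS aA'' => N /inA[].
    * by apply: filterS ay => N /negbTE.
    * by have [_ [_]] := h1 j jm; apply: filterS => N /negbTE.
    * by have [+ _] := h1 i im; apply: filterS => N /inA[].
    * exact: h2.
Qed.

Lemma ladder_free_dense (d : nat) (x0 : forall N, X N) (y0 : forall N, Y N) :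
    U (fun N => forall a b, ~ ladder (S N) d a b) ->
  dense (sections S).
Proof.
move=> st A lA; apply: contrapT => no.
have r : rich A (fun=> True).
  split=> // A' sA' lA'; apply: contrapT => no'; apply: no.
  exists A' => //; split=> // _ [y ->] sy; apply: no'; by exists y.
have near2 (p : nat) (Q : nat -> nat -> nat -> Prop) :
    (forall i j, i < p -> j < p -> U (Q i j)) ->
    U (fun N => forall i, i < p -> forall j, j < p -> Q i j N).
  by move=> h; apply: near_ltn => i ip; apply: near_ltn => j jp; apply: h.
(* The strict order needs length [d.+1]: dropping [a 0] and [b d] and reversing turns [j < i] into
   [i <= j] with [d] rungs. *)
have [[a [b [_ /near2 h]]]|[a [b [_ /near2 h]]]] := rich_ladder x0 y0 d d.+1 r.
  have [N [hN nN]] := near_ex2 h st.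
  by apply: (nN (a^~ N) (b^~ N)) => i j id jd; apply: hN.
have [N [hN nN]] := near_ex2 h st.
apply: (nN (fun i => a (d - i) N) (fun i => b (d.-1 - i) N)) => i j id jd.
by rewrite hN; lia.
Qed.

End Ladder.

(** * Saturation and exhaustion by atoms *)

Lemma large_saturation (c : nat) (R : nat -> forall N, {set X N}) :
    (forall j, sub (R j.+1) (R j)) -> (forall j, large_by c (R j)) ->
  exists2 Q, large_by c Q & forall j, U (fun N => Q N \subset R j N).
Proof.
move=> dec lR.
have mono N i j : i <= j -> R j N \subset R i N.
  elim: j => [|j IH]; first by rewrite leqn0 => /eqP->.
  rewrite leq_eqVlt => /predU1P[-> //|]; rewrite ltnS => /IH.
  exact: subset_trans (dec j N).
(* At index [N] the diagonal takes the last [R j N] with [j <= N] that still has the required size;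
   the bound [j <= N] makes the maximum exist. *)
pose ok N j := (#|X N| <= c * #|R j N|) && (j <= N).
exists (fun N => R (\max_(j < N.+1 | ok N j) j) N).
  apply: filterS (lR 0) => N h0.
  have [|j /andP[h _] jmax] :=
    @eq_bigmax_cond _ [pred j : 'I_N.+1 | ok N j] (fun j => j).
    by apply/card_gt0P; exists ord0; rewrite inE /ok h0.
  by have -> : \max_(j < N.+1 | ok N j) j = j by [].
move=> j; apply: filterS2 (lR j) (U_infty j) => N hj jN; apply: mono.
have jN' : j < N.+1 by [].
apply: (@leq_bigmax_cond _ (fun j : 'I_N.+1 => ok N j) (fun j => j)
  (Ordinal jN')).
by rewrite /ok hj.
Qed.

(** Sizes are compared through the integers [c] alone, so that a minimum over all atoms inside [A]
    exists. *)
Lemma best_atom Fam A : dense Fam -> large A ->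
  exists B, [/\ sub B A, atom Fam B &
    forall c B', sub B' A -> atom Fam B' -> large_by c B' -> large_by c B].
Proof.
move=> dF /dF[B0 sB0 aB0].
pose P c := `[< exists B, [/\ sub B A, atom Fam B & large_by c B] >].
have exP : exists c, P c.
  have [c hc] := aB0.1; exists c; apply/asboolP; by exists B0.
case: (ex_minnP exP) => c0 /asboolP[B [sB aB lB]] cmin.
exists B; split=> // c B' sB' aB' lB'.
have /cmin c0c : P c by apply/asboolP; exists B'.
by apply: filterS lB => N /leq_trans; apply; rewrite leq_mul2r c0c orbT.
Qed.

Lemma card_disjoint_pick (T : finType) (A R : nat -> {set T}) n :
    R 0 = setT -> (forall j, R j.+1 = R j :\: A j) ->
    (forall j, A j \subset R j) ->
  \sum_(j < n) #|A j| + #|R n| = #|T|.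
Proof.
move=> R0 RS sA; elim: n => [|n IH]; first by rewrite big_ord0 R0 cardsT.
rewrite big_ord_recr /= -addnA RS -IH; congr (_ + _).
by rewrite -(cardsID (A n) (R n)) (setIidPr (sA n)).
Qed.

(** If the remainders never became small against the first atom, saturation would give a large [Q]
    inside all of them along [U], and an atom [B] in [Q]. As [B] competed at every step, all atoms
    picked share its lower density bound, which is impossible for disjoint sets. *)
Lemma exhaustion Fam (e : nat) : dense Fam ->
  exists (n : nat) (A : nat -> forall N, {set X N}),
    [/\ 0 < n, (forall t, t < n -> atom Fam (A t)),
        (forall N s t, s < n -> t < n -> s != t -> [disjoint A s N & A t N]) &
        U (fun N => e * #|~: \bigcup_(s < n) A s N| <= #|A 0 N|)].
Proof.
move=> dF.
have ex R : exists B, sub B R /\ (large R -> atom Fam B /\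
    forall c B', sub B' R -> atom Fam B' -> large_by c B' -> large_by c B).
  have [lR|nR] := pselect (large R); last first.
    by exists R; split=> // N.
  by have [B [sB aB hB]] := best_atom dF lR; exists B.
pose pick R := sval (cid (ex R)).
pose R := fix R j : forall N, {set X N} :=
  if j is j'.+1 then fun N => R j' N :\: pick (R j') N else fun N => setT.
pose A j := pick (R j).
have sA j : sub (A j) (R j) by case: (svalP (cid (ex (R j)))).
have bA j : large (R j) -> atom Fam (A j) /\
    forall c B', sub B' (R j) -> atom Fam B' -> large_by c B' ->
      large_by c (A j).
  by case: (svalP (cid (ex (R j)))).
have dec N i j : i <= j -> R j N \subset R i N.
  elim: j => [|j IH]; first by rewrite leqn0 => /eqP->.
  rewrite leq_eqVlt => /predU1P[-> //|]; rewrite ltnS => /IH.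
  exact: subset_trans (subsetDl _ _).
have RE N n : R n N = ~: \bigcup_(s < n) A s N.
  elim: n => [|n IH]; first by rewrite big_ord0 setC0.
  by rewrite big_ord_recr /= setCU -IH setDE.
have dis N s t : s != t -> [disjoint A s N & A t N].
  have lt i j : i < j -> [disjoint A i N & A j N].
    move=> ij; rewrite disjoint_sym disjoints_subset.
    apply: subset_trans (sA j N) _; apply: subset_trans (dec N _ _ ij) _.
    by rewrite /= setDE subsetIr.
  by rewrite neq_ltn => /orP[/lt //|/lt]; rewrite disjoint_sym.
have lR0 : large (R 0) by exact: largeT.
have [[n [n0 hn ln]]|no] := pselect (exists n, [/\ 0 < n,
    U (fun N => e * #|R n N| <= #|A 0 N|) & forall t, t < n -> large (R t)]).
  exists n, A; split=> //.
  - by move=> t tn; have [] := bA t (ln t tn).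
  - by move=> *; apply: dis.
  - by apply: filterS hn => N; rewrite RE.
have [[[c0 lA0] _] _] := bA 0 lR0.
(* Later remainders satisfy the bound with [c0 * e], by comparison with [A 0]; the successor keeps
   the constant positive for [R 0]. *)
have lR j : large_by (c0 * e).+1 (R j).
  elim/ltn_ind: j => -[_|j IH].
    by apply: filterE => N; rewrite /= cardsT mulSn leq_addr.
  have /ultra_not : ~ U (fun N => e * #|R j.+1 N| <= #|A 0 N|).
    move=> h; apply: no; exists j.+1; split=> // t tj.
    by exists (c0 * e).+1; apply: IH.
  by apply: filterS2 lA0 => N h1 h2; nia.
have [Q lQ sQ] := large_saturation (fun j N => dec N _ _ (leqnSn j)) lR.
have [B sB aB] := dF Q (ex_intro (large_by^~ Q) _ lQ).
have [[c lB] _] := aB.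
(* [B] lies in [R j] only along [U], so its trace on [R j] enters the competition instead. *)
have lA j : large_by c (A j).
  have near_eq : U (fun N => B N \subset B N :&: R j N).
    apply: filterS (sQ j) => N h.
    by rewrite subsetI subxx (subset_trans (sB N)).
  have lBR : large_by c (fun N => B N :&: R j N) by apply: large_by_sub lB.
  have [_ /(_ c (fun N => B N :&: R j N))] :=
    bA j (ex_intro (large_by^~ (R j)) _ (lR j)).
  apply=> //; first by move=> N; apply: subsetIr.
  by apply: atom_sub aB; [move=> N; apply: subsetIl|exists c].
(* [c.+1] disjoint sets of density at least [1/c] do not fit into [X N]. *)
have [N [hN _]] :=
  near_ex2 (near_ltn (fun j (_ : j < c.+1) => lA j)) (U_infty 0).
have := @card_disjoint_pick _ (A^~ N) (R^~ N) c.+1 erefl (fun=> erefl) (sA^~ N).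
have : \sum_(j < c.+1) #|X N| <= \sum_(j < c.+1) c * #|A j N|.
  by apply: leq_sum => j _; apply: hN.
rewrite sum_nat_const card_ord -big_distrr /=; have := X_gt0 N.
move: (\sum_(i < c.+1) #|A i N|) => s XN_gt0; rewrite mulSn => h1 h2.
have : c * s <= c * #|X N| by rewrite leq_mul2l -h2 leq_addr orbT.
by move/(leq_trans h1); rewrite -[leqRHS]add0n leq_add2r leqNgt XN_gt0.
Qed.

End Largeness.
End Ultraproduct.

(** * Majority relations *)

Definition majority (X Y Z : finType) (E : {set X * Y * Z}) (C : {set Z})
    (x : X) (y : Y) : bool :=
  #|C| <= 2 * #|C :&: [set z | (x, y, z) \in E]|.

(** The summand 3 makes the small side the minority side, unless [C] is empty. *)
Lemma majority_close (X Y Z : finType) (E : {set X * Y * Z}) (C : {set Z})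
    c x y :
    good (c + 3) C [set z | (x, y, z) \in E] ->
  c * #|[set z in C | ((x, y, z) \in E) != majority E C x y]| <= #|C|.
Proof.
have := cardsID [set z | (x, y, z) \in E] C.
set P := C :&: _; set Q := C :\: _ => cPQ gd.
have -> : #|[set z in C | ((x, y, z) \in E) != majority E C x y]| =
    if majority E C x y then #|Q| else #|P|.
  case: majority; apply: eq_card => z; rewrite !inE.
    by rewrite eqb_id andbC.
  by rewrite eqbF_neg negbK.
move: cPQ gd; rewrite /good -/P -/Q /majority -/P.
move: #|P| #|Q| #|C| => p q r <- gd.
have {gd} : 3 * p + c * p <= p + q \/
    3 * q + c * q <= p + q.
  by case: gd => gd; [left|right]; rewrite -mulnDl [3 + c]addnC.
case: (leqP (p + q)) => h [] h'; [|lia|lia|lia].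
have [-> ->] : p = 0 /\ q = 0 by lia.
by rewrite muln0.
Qed.

(** Union bound: fewer than [#|C|] points [z] of [C] are exceptions for one of the [d * d] pairs of
    the ladder, so the slice at some [z] copies the ladder. *)
Lemma majority_ladder_free (X Y Z : finType) (E : {set X * Y * Z})
    (C : {set Z}) (g : X -> Y -> bool) d a b :
    C != set0 ->
    (forall x y,
       (d * d + 1) * #|[set z in C | ((x, y, z) \in E) != g x y]| <= #|C|) ->
    (forall z, stable d (slice3 E z)) ->
  ~ ladder g d a b.
Proof.
move=> C0 close st lad.
pose bad i j := [set z in C | ((a i, b j, z) \in E) != g (a i) (b j)].
have lt : #|\bigcup_(i < d) \bigcup_(j < d) bad i j| < #|C|.
  have le : #|\bigcup_(i < d) \bigcup_(j < d) bad i j| <=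
      \sum_(i < d) \sum_(j < d) #|bad i j|.
    apply: leq_trans (card_big_setU _ _ _) _.
    by apply: leq_sum => i _; apply: card_big_setU.
  have : (d * d + 1) * \sum_(i < d) \sum_(j < d) #|bad i j| <= d * (d * #|C|).
    rewrite -[X in X * (X * #|C|)](card_ord d) -!sum_nat_const big_distrr.
    apply: leq_sum => i _; rewrite /= big_distrr; apply: leq_sum => j _.
    exact: close.
  move: C0; rewrite -card_gt0; move: (\sum_(i < d) _) le => s le; nia.
have [z zC zn] : exists2 z, z \in C &
    z \notin \bigcup_(i < d) \bigcup_(j < d) bad i j.
  apply/subsetPn; apply: contraL lt => /subset_leq_card; rewrite -leqNgt.
  exact.
apply: (stable_ladder (a := a) (b := b) (st z)) => i j id jd.
rewrite inE -lad //; apply/eqP; apply: contraNT zn => ne.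
apply/bigcupP; exists (Ordinal id) => //.
apply/bigcupP; exists (Ordinal jd) => //.
by rewrite inE zC.
Qed.

(** * Regularity along the ultrafilter *)

(** A form with integers only: [e] stands for [1/eps] and [c n] for [2/f(n)], where 2 is the factor
    from [box_homogeneous]. *)
Definition counting_regular (e : nat) (c : nat -> nat) (N : nat)
    (H : hypergraph3) : Prop :=
  exists (n : nat) (A1 : nat -> {set part1 H}) (A2 : nat -> {set part2 H})
      (A3 : nat -> {set part3 H}),
    [/\ 1 < n <= N,
        [/\ partition_into n A1, partition_into n A2 & partition_into n A3],
        [/\ e * #|A1 0| <= #|A1 1|, e * #|A2 0| <= #|A2 1|
          & e * #|A3 0| <= #|A3 1|]
      & forall t1 t2 t3 : nat, 1 <= t1 -> 1 <= t2 -> 1 <= t3 ->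
          let V := setX (setX (A1 t1) (A2 t2)) (A3 t3) in
          c n * #|edges H :&: V| <= 2 * #|V| \/
          c n * #|V :\: edges H| <= 2 * #|V|].

Lemma limit_regularity (U : set_system nat) (UU : UltraFilter U)
    (U_infty : forall m, U (fun N => m <= N)) (H : nat -> hypergraph3)
    (d e : nat) (c : nat -> nat) :
    (forall N, slicewise_stable d (H N)) ->
  U (fun N => counting_regular e c N (H N)).
Proof.
move=> stH.
pose X N := part1 (H N); pose Y N := part2 (H N); pose Z N := part3 (H N).
pose XY N : finType := (X N * Y N)%type.
pose x0 N : X N := enum_val (Ordinal (part1_gt0 (H N))).
pose y0 N : Y N := enum_val (Ordinal (part2_gt0 (H N))).
pose z0 N : Z N := enum_val (Ordinal (part3_gt0 (H N))).
pose SZ N (z : Z N) (xy : XY N) := (xy, z) \in edges (H N).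
have dZ : dense U (sections SZ).
  apply: (ladder_free_dense UU (fun N => part3_gt0 (H N)) (d := d) z0
    (fun N => (x0 N, y0 N))).
  apply: filterE => N a b lad.
  exact: (stable_ladder (stH N).1 (ladder_tr lad)).
have [p [C [p0 aC disC restC]]] :=
  exhaustion UU U_infty (fun N => part3_gt0 (H N)) e dZ.
pose g k N (x : X N) (y : Y N) := majority (edges (H N)) (C k N) x y.
have close k K : k < p -> U (fun N => forall x y,
    K * #|[set z in C k N | ((x, y, z) \in edges (H N)) != g k N x y]|
      <= #|C k N|).
  move=> kp.
  have := atom_good UU (K + 3) (fun N => (x0 N, y0 N)) (fun _ h => h) (aC k kp).
  by apply: filterS => N h x y; apply: majority_close; apply: (h (x, y)).
have free k : k < p -> U (fun N => forall a b, ~ ladder (g k N) d a b).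
  move=> kp; have [lC _] := aC k kp.
  apply: filterS2 (large_nonempty UU (fun N => part3_gt0 (H N)) lC)
    (close k (d * d + 1) kp) => N C0 cl a b.
  exact: majority_ladder_free C0 cl (stH N).2.
have dX : dense U (fun F => exists2 k, k < p & sections (g k) F).
  apply: dense_unions => // k kp.
  by apply: (ladder_free_dense UU (fun N => part1_gt0 (H N)) x0 y0 (free k kp)).
have dY : dense U
    (fun F => exists2 k, k < p & sections (fun N y x => g k N x y) F).
  apply: dense_unions => // k kp.
  apply: (ladder_free_dense UU (fun N => part2_gt0 (H N)) (d := d) y0 x0).
  apply: filterS (free k kp) => N fr a b lad.
  exact: (fr _ _ (ladder_tr lad)).
have [q [A [q0 aA disA restA]]] :=
  exhaustion UU U_infty (fun N => part1_gt0 (H N)) e dX.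
have [r [B [r0 aB disB restB]]] :=
  exhaustion UU U_infty (fun N => part2_gt0 (H N)) e dY.
(* The atoms are fixed by now, so the number [m.+1] of parts is known before the accuracy [K] is
   derived from it. *)
pose m := maxn p (maxn q r); pose K := c m.+1.
have gA : U (fun N => forall s, s < q -> forall k, k < p -> forall y,
    good (4 * K) (A s N) [set x | g k N x y]).
  apply: near_ltn => // s sq; apply: near_ltn => // k kp.
  by apply: (atom_good UU (4 * K) y0) (aA s sq) => F FS; exists k.
have gB : U (fun N => forall s, s < r -> forall k, k < p -> forall x,
    good (4 * K) (B s N) [set y | g k N x y]).
  apply: near_ltn => // s sr; apply: near_ltn => // k kp.
  apply: (atom_good UU (4 * K) (S := fun N y x => g k N x y) x0) (aB s sr).
  move=> F FS.
  by exists k.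
have gC : U (fun N => forall k, k < p -> forall x y,
    K * #|[set z in C k N | ((x, y, z) \in edges (H N)) != g k N x y]|
      <= #|C k N|).
  by apply: near_ltn => // k kp; apply: close.
(* These conditions hold together along [U], among them [m.+1 <= N]; the rest takes place at one
   such [N]. *)
apply: filterS (filterI (filterI restA (filterI restB restC))
  (filterI (U_infty m.+1) (filterI gA (filterI gB gC)))).
move=> N [[rA [rB rC]] [mN [hA [hB hC]]]].
exists m.+1, (parts_of q (A^~ N)), (parts_of r (B^~ N)), (parts_of p (C^~ N)).
split.
- by rewrite mN ltnS leq_max p0.
- by split; [apply: parts_of_partition (disA N)
            |apply: parts_of_partition (disB N)
            |apply: parts_of_partition (disC N)];
     rewrite /m !leq_max leqnn ?orbT.
- by rewrite /= q0 r0 p0.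
have V0 (V : {set X N * Y N * Z N}) :
    #|V| = 0 -> K * #|edges (H N) :&: V| <= 2 * #|V|.
  by move=> /cards0_eq ->; rewrite setI0 cards0 muln0.
move=> [|t1] [|t2] [|t3] // _ _ _ /=.
case: ifP => h1; last by left; apply: V0; rewrite !cardsX cards0 ?mul0n ?muln0.
case: ifP => h2; last by left; apply: V0; rewrite !cardsX cards0 ?mul0n ?muln0.
case: ifP => h3; last by left; apply: V0; rewrite !cardsX cards0 ?mul0n ?muln0.
apply: (box_homogeneous (g := g t3 N)) => [x y|y|x].
- exact: hC.
- exact: hA.
- exact: hB.
Qed.

(** The hypergraph at index [N] refutes the bound [N] itself, while a number of parts that is
    constant along the sequence is at most [N] along [U]. *)
Lemma slicewise_stable_counting_regular (d e : nat) (c : nat -> nat) :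
  exists N : nat, forall H, slicewise_stable d H -> counting_regular e c N H.
Proof.
apply: contrapT => /forallNP no.
have ex N : exists H, ~ (slicewise_stable d H -> counting_regular e c N H).
  exact/existsNP.
pose H N := sval (cid (ex N)).
have HP N : ~ (slicewise_stable d (H N) -> counting_regular e c N (H N)).
  exact: svalP (cid (ex N)).
have [U [UU infU]] := ultraFilterLemma eventually_filter.
have U_infty m : U (fun N => m <= N) by apply: infU; exists m.
have st N : slicewise_stable d (H N) by have /not_implyP[] := HP N.
have [N [regN _]] :=
  near_ex2 UU (limit_regularity UU U_infty e c st) (U_infty 0).
by have /not_implyP[_] := HP N; apply.
Qed.

(** * Passage to real densities *)

Import Order.TTheory GRing.Theory Num.Theory.
Local Open Scope ring_scope.

Lemma density_le (R : realType) (T : finType) (E V : {set T}) (c : nat)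
    (f : R) :
    #|V| <> 0%N -> 0 < f -> 2 / f < c%:R ->
    (c * #|E :&: V| <= 2 * #|V|)%N ->
  density R E V < f.
Proof.
move=> V0 f0 fc cE.
have V0' : (0 : R) < #|V|%:R by rewrite ltr0n lt0n; apply/eqP.
rewrite /density ltr_pdivrMr //.
have c0 : (0 : R) < c%:R by apply: lt_trans fc; rewrite divr_gt0.
rewrite -(ltr_pM2l c0); have : c%:R * #|E :&: V|%:R <= 2 * #|V|%:R :> R.
  by rewrite -!natrM ler_nat.
move/le_lt_trans; apply; rewrite mulrA ltr_pM2r //.
by rewrite -ltr_pdivrMr.
Qed.

Lemma density_setC (R : realType) (T : finType) (E V : {set T}) :
  #|V| <> 0%N -> density R E V = 1 - density R (~: E) V.
Proof.
move=> /eqP V0; have V0' : (#|V|%:R : R) != 0 by rewrite pnatr_eq0.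
apply/eqP; rewrite eq_sym subr_eq /density -mulrDl -natrD.
by rewrite ![_ :&: V]setIC -setDE cardsID divff.
Qed.

Lemma density_ge0 (R : realType) (T : finType) (E V : {set T}) :
  0 <= density R E V.
Proof. exact: divr_ge0. Qed.

Theorem theorem4 (R : realType) (d : nat) :
  strong_stable_regularity R (slicewise_stable d).
Proof.
move=> eps f eps0 f01.
have f0 n : 0 < f n by have := f01 n; rewrite in_itv => /andP[].
(* Integers above [1/eps] and [2/f(n)], by the Archimedean property. *)
pose e := Num.bound eps^-1; pose c n := Num.bound (2 / f n).
have [N hN] := slicewise_stable_counting_regular d e c.
have small (T : finType) (A B : {set T}) : (e * #|A| <= #|B|)%N ->
    #|A|%:R <= eps * #|B|%:R.
  rewrite -(ler_nat R) natrM => le.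
  rewrite -ler_pdivrMl //; apply: le_trans le; rewrite ler_wpM2r //.
  by apply/ltW/archi_boundP; rewrite invr_ge0 ltW.
exists N => H /hN[n [A1 [A2 [A3 [nN part [e1 e2 e3] reg]]]]].
exists n, A1, A2, A3; split=> //; first by split; apply: small.
move=> t1 t2 t3 /andP[t1_gt0 _] /andP[t2_gt0 _] /andP[t3_gt0 _] V V0.
have cn : 2 / f n < (c n)%:R by apply: archi_boundP; rewrite divr_ge0 // ltW.
have [h|] := reg _ _ _ t1_gt0 t2_gt0 t3_gt0; [left|
  rewrite setDE setIC => h; right].
  by rewrite in_itv /= density_ge0 (density_le V0 (f0 n) cn h).
rewrite in_itv /= density_setC // ltrD2l ltrN2 (density_le V0 (f0 n) cn h) /=.
by rewrite gerBl density_ge0.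
Qed.
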